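(* There exists a numerical constant $c>1$ such that the following holds for every metric space $(M,d)$, every metric subspace $M^{o}\subset M$ (with the induced metric $d^{o}:=d|_{M^{o}\times M^{o}}$), every Borel measure $\mu^{o}$ on $M^{o}$ that is doubling with respect to $d^{o}$, and every Banach space $X$: there exists a simultaneous extension $E: Lip(M^{o},X)\to Lip(M,X)$ satisfying $$\|E\|\leq c\,(\log_{2} D(\mu^{o})+1).$$
   Context: For a metric space $(M,d)$ and a Banach space $X$, $Lip(M,X)$ is the space of all $X$-valued Lipschitz functions on $M$, with seminorm $$L(f):=\sup_{m\neq m'}\frac{\|f(m)-f(m')\|}{d(m,m')},\qquad m,m'\in M.$$ A linear operator $E: Lip(M^{o},X)\to Lip(M,X)$ is a simultaneous extension if $Ef|_{M^{o}}=f$ for all $f\in Lip(M^{o},X)$ and its norm $\|E\|:=\sup\{L(Ef)/L(f) : f\in Lip(M^{o},X)\}$ is finite (that is, $\|E\|$ is the smallest $C<\infty$ with $L(Ef)\le C\,L(f)$ for all $f$). A Borel measure $\mu$ on a metric space $(M,d)$ is doubling if every open ball $B_{R}(m):=\{m'\in M: d(m,m')<R\}$ has strictly positive and finite $\mu$-measure and the doubling constant $$D(\mu):=\sup\left\{\frac{\mu(B_{2R}(m))}{\mu(B_{R}(m))} : m\in M,\ R>0\right\}$$ is finite. *)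

(* Defs.v *)
From HB Require Import structures.
From mathcomp Require Import all_boot all_order all_algebra.
From mathcomp Require Import all_classical all_reals all_analysis.

Set Implicit Arguments.
Unset Strict Implicit.
Unset Printing Implicit Defensive.

Import Order.TTheory GRing.Theory Num.Theory.
Import numFieldNormedType.Exports.

Local Open Scope classical_set_scope.
Local Open Scope ring_scope.

Section metric_subspace.
Context {R : realType} {M : metricType R} (A : set M).

Let subdist (x y : A) : R := mdist (\val x) (\val y).

Let subdist_ge0 (x y : A) : 0 <= subdist x y.
Proof. exact: mdist_ge0. Qed.

Let subdist_positivity (x y : A) : subdist x y = 0 -> x = y.
Proof. by move=> /mdist_positivity/val_inj. Qed.

Let ballEsubdist (x : A) (e : R) : ball x e = [set y | subdist x y < e].
Proof. by rewrite -initial_ballE ballEmdist. Qed.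

(* The library already gives the subtype [A : Type] the induced topology and
   pseudometric; here the induced distance is added. *)
HB.instance Definition _ := @PseudoMetric_isMetric.Build R (A : Type)
  subdist subdist_ge0 subdist_positivity ballEsubdist.

End metric_subspace.

(* Library measurable types are pointed.  [borelType p] is the type [T] with
   its Borel sigma-algebra; the point [p] only witnesses that [T] is nonempty,
   and the sigma-algebra does not depend on it. *)
Definition borelType {T : topologicalType} (p : T) : Type := T.

Section borel.
Context {T : topologicalType} (p : T).

Let borelC (A : set T) : <<s @open T >> A -> <<s @open T >> (~` A).
Proof. by move=> mA; rewrite -setTD; exact: sigma_algebraCD. Qed.

HB.instance Definition _ := Choice.copy (borelType p) T.
HB.instance Definition _ := isPointed.Build (borelType p) p.
HB.instance Definition _ := @isMeasurable.Build (sigma_display (@open T))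
  (borelType p) <<s @open T >> (@sigma_algebra0 _ setT (@open T)) borelC
  (@sigma_algebra_bigcup _ setT (@open T)).

End borel.

Section doubling.
Context {R : realType} {T : metricType R} (mu : set T -> \bar R).

Definition doubling_constant : \bar R :=
  ereal_sup [set z | exists m r, 0 < r /\
    z = (mu (ball m (2 * r)) / mu (ball m r))%E].

Definition is_doubling : Prop :=
  (forall (m : T) (r : R), 0 < r ->
     (0 < mu (ball m r))%E /\ (mu (ball m r) < +oo)%E) /\
  (doubling_constant < +oo)%E.

End doubling.

Definition log2 {R : realType} (x : R) : R := ln x / ln 2.

Section lipschitz_space.
Context {R : realType} (T : metricType R) (X : normedModType R).

Definition lip_quotients (f : T -> X) : set R :=
  [set z | exists m m', m != m' /\ z = `|f m - f m'| / mdist m m'].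

(* This is used only for [f] in [Lip T X], where the set of quotients is
   bounded above.  If [T] is a single point then [sup set0 = 0]. *)
Definition lip_seminorm (f : T -> X) : R := sup (lip_quotients f).

Definition lip_fun : {pred T -> X} :=
  mem [set f : T -> X | has_ubound (lip_quotients f)].

Lemma lip_funP (f : T -> X) :
  f \in lip_fun <->
  exists C, forall m m', `|f m - f m'| <= C * mdist m m'.
Proof.
rewrite /lip_fun inE /=; split=> -[C fC]; exists C.
  move=> m m'; have [->|mm'] := eqVneq m m'.
    by rewrite subrr normr0 mdistxx mulr0.
  by rewrite -ler_pdivrMr ?mdist_gt0//; apply: fC; exists m, m'.
move=> _ [m [m' [mm' ->]]].
by rewrite ler_pdivrMr ?mdist_gt0.
Qed.

Let lip_fun_submod_closed : submod_closed lip_fun.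
Proof.
split; first by apply/lip_funP; exists 0 => m m'; rewrite subrr normr0 mul0r.
move=> a f g /lip_funP[C fC] /lip_funP[D gD]; apply/lip_funP.
exists (`|a| * C + D) => m m'.
rewrite mulrDl -mulrA.
have -> : (a *: f + g) m - (a *: f + g) m' = a *: (f m - f m') + (g m - g m').
  by rewrite scalerBr addrACA -opprD.
by rewrite (le_trans (ler_normD _ _))// normrZ lerD// ler_wpM2l.
Qed.

HB.instance Definition _ :=
  GRing.isSubmodClosed.Build R (T -> X) lip_fun lip_fun_submod_closed.

Record Lip : Type := MkLip {
  lip_val :> T -> X ;
  lip_valP : lip_val \in lip_fun }.

HB.instance Definition _ := [isSub for lip_val].
HB.instance Definition _ := [Choice of Lip by <:].
HB.instance Definition _ := [SubChoice_isSubLmodule of Lip by <:].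

End lipschitz_space.

Section extension.
Context {R : realType} {M : metricType R} {A : set M} {X : normedModType R}.
Variable E : {linear Lip A X -> Lip M X}.

(* The smallest [C] with [L (E f) <= C * L f] for all [f], and [+oo] if there
   is none. *)
Definition ext_norm : \bar R :=
  ereal_inf [set C%:E | C in [set C : R | 0 <= C /\
    forall f : Lip A X, lip_seminorm (E f) <= C * lip_seminorm f]].

Definition simultaneous_extension : Prop :=
  (forall (f : Lip A X) (m : A), E f (\val m) = f m) /\ (ext_norm < +oo)%E.

End extension.

(* Main.v *)
Require Import Defs.
From HB Require Import structures.
From mathcomp Require Import all_boot all_order all_algebra.
From mathcomp Require Import finmap zify ring lra.
From mathcomp Require Import all_classical all_reals all_analysis.
Import Order.TTheory GRing.Theory Num.Theory.
Import numFieldNormedType.Exports.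
Local Open Scope classical_set_scope.
Local Open Scope ring_scope.

(** The extension is an average: for [x] at distance [r x > 0] from [Mo],
    [E f x] is a finite convex combination [\sum_i p x i *: f (z i)] of values
    of [f] at points [z i] of [Mo] whose distance to [x] is comparable to [r x].
    Such an average is linear in [f], and since the coefficients sum to [1], the
    difference [E f x - E f y] is controlled by the total variation
    [\sum_i `|p x i - p y i|] times the diameter [O(r x)] of the nodes in use.
    So it suffices that this total variation is at most
    [O(n) * mdist x y / r x] with [n = ln D + 1], where [D] is the doubling
    constant; and only for [mdist x y <= r x / (70 * n)], because for more
    distant points the bound [`|E f x - f z| <= O(1) * L * mdist x z] already
    gives [`|E f x - E f y| <= O(n) * L * mdist x y].  A family of coefficients
    with these properties is a [gentle_partition], and
    [simultaneous_extension_of_gentle_partition] is the resulting extension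
    principle.

    The logarithm comes from the choice of weights.  A node [i = (z, j)]
    consists of an integer level [j] and a point [z] of a maximal subset of [Mo]
    around the points of which the balls of radius [exp j / 2] are disjoint; its
    mass is the measure of that ball at [z], and its weight at [x] is its mass
    times [exp (- n * s)], truncated where [s] reaches [16], with [s] about
    [mdist x z / r x] and with levels [j] far from [ln (r x)] excluded.  The
    logarithmic derivative of these weights is [O(n / r x)] wherever the
    truncation is harmless.  It is harmless because balls of comparable radius
    around comparable centres have measures within a factor [D ^+ k <= exp (k * n)]
    of each other: all the nodes with [s < 17] together have mass at most
    [exp (10 * n)] times that of a node [i0] with [s < 3]
    ([sum_mass_le]), so the part of their exponential weight that truncation
    removes, at most [exp (- 16 * n)] times their mass, is dominated by the
    weight of [i0] alone ([sum_exp_mass_le]).  Normalizing the weights gives the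
    gentle partition [node_partition_gentle].

    Working with discrete nodes rather than with the measure itself makes every
    average a finite linear combination in [X] instead of a vector-valued integral.
    Completeness of [X] serves at the points of the closure of [Mo], where
    [E f x] is the limit of [f] along points of [Mo] tending to [x]. *)

(** * Lipschitz seminorms and the distance to a subset *)

Section lipschitz_seminorm.
Context {R : realType} {T : metricType R} {X : normedModType R}.

Lemma lip_dist_le (f : Lip T X) (x y : T) :
  `|f x - f y| <= lip_seminorm f * mdist x y.
Proof.
have [->|xy] := eqVneq x y; first by rewrite subrr normr0 mdistxx mulr0.
rewrite -ler_pdivrMr ?mdist_gt0//; apply: sup_upper_bound; last by exists x, y.
split; first by exists (`|f x - f y| / mdist x y), x, y.
by have := lip_valP f; rewrite /lip_fun inE.
Qed.

Lemma lip_seminorm_ge0 (f : Lip T X) : 0 <= lip_seminorm f.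
Proof.
rewrite /lip_seminorm.
have [->|/set0P[_ [x [y [xy _]]]]] := eqVneq (lip_quotients f) set0.
  by rewrite sup0.
have := lip_dist_le f x y; have := normr_ge0 (f x - f y).
by move=> /le_trans/[apply]; rewrite pmulr_lge0// mdist_gt0.
Qed.

Lemma lip_seminorm_le (f : T -> X) (C : R) : 0 <= C ->
  (forall x y, `|f x - f y| <= C * mdist x y) -> lip_seminorm f <= C.
Proof.
move=> C0 fC; rewrite /lip_seminorm.
have [->|/set0P ne] := eqVneq (lip_quotients f) set0; first by rewrite sup0.
apply: ge_sup => // _ [x [y [xy ->]]].
by rewrite ler_pdivrMr ?mdist_gt0.
Qed.

End lipschitz_seminorm.

Section set_dist.
Context {R : realType} {M : metricType R} (A : set M).

Definition set_dist (x : M) : R := inf [set mdist x (\val z) | z in [set: A]].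

Lemma set_dist_le (x : M) (z : A) : set_dist x <= mdist x (\val z).
Proof.
apply: ge_inf; last by exists z.
by exists 0 => _ [y _ <-]; exact: mdist_ge0.
Qed.

Context (a : A).

Lemma set_dist_ge0 (x : M) : 0 <= set_dist x.
Proof.
apply: lb_le_inf; first by exists (mdist x (\val a)), a.
by move=> _ [y _ <-]; exact: mdist_ge0.
Qed.

Lemma set_dist_adherent (x : M) (e : R) : 0 < e ->
  exists z : A, mdist x (\val z) < set_dist x + e.
Proof.
move=> e0; pose S := [set mdist x (\val z) | z in [set: A]].
have [|_ [z _ <-] ?] := @inf_adherent _ S _ e0.
  split; first by exists (mdist x (\val a)), a.
  by exists 0 => _ [y _ <-]; exact: mdist_ge0.
by exists z.
Qed.

Lemma set_dist_triangle (x y : M) : set_dist x <= set_dist y + mdist x y.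
Proof.
apply/ler_addgt0Pr => e e0; have [z yz] := set_dist_adherent y e e0.
have := set_dist_le x z; have := metric_triangle x y (\val z).
lra.
Qed.

End set_dist.

(** * Extension from a gentle partition *)

Section bounded_operators.
Context {R : realType} {M : metricType R} (A : set M) (X : normedModType R).

Lemma simultaneous_extension_of_lipschitz_operator
    (F : Lip A X -> M -> X) (C : R) : 0 <= C ->
  (forall f x y, `|F f x - F f y| <= C * lip_seminorm f * mdist x y) ->
  (forall (k : R) f g x, F (k *: f + g) x = k *: F f x + F g x) ->
  (forall f (z : A), F f (\val z) = f z) ->
  exists E : {linear Lip A X -> Lip M X},
    simultaneous_extension E /\ (ext_norm E <= C%:E)%E.
Proof.
move=> C0 FC Flin Fext.
have Flip f : F f \in @lip_fun R M X.
  by apply/lip_funP; exists (C * lip_seminorm f); exact: FC.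
pose E0 f := MkLip (Flip f).
have E0lin : linear E0.
  by move=> k f g; apply: val_inj; apply/funext => x /=; exact: Flin.
pose E : {linear Lip A X -> Lip M X} := HB.pack E0
  (GRing.isLinear.Build R (Lip A X) (Lip M X) *:%R E0 E0lin).
have EC : (ext_norm E <= C%:E)%E.
  apply: ereal_inf_lbound; exists C => //; split => // f.
  apply: lip_seminorm_le; last exact: FC.
  by apply: mulr_ge0 => //; exact: lip_seminorm_ge0.
exists E; split => //; split => //.
by rewrite (le_lt_trans EC)// ltry.
Qed.

End bounded_operators.

Section finite_sums.
Context {R : realType} {I : choiceType} {V : normedModType R}.

Lemma fsum_scaleE (p : I -> R) (F : {fset I}) (v : I -> V) :
  (forall i, p i != 0 -> i \in F) ->
  \sum_(i \in [set: I]) p i *: v i = \sum_(i <- F) p i *: v i.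
Proof.
move=> pF; apply: fsbigTE => i iF.
by have [->|/pF] := eqVneq (p i) 0; [rewrite scale0r|rewrite (negbTE iF)].
Qed.

Lemma fsumE (p : I -> R) (F : {fset I}) :
  (forall i, p i != 0 -> i \in F) ->
  \sum_(i \in [set: I]) p i = \sum_(i <- F) p i.
Proof.
move=> pF; apply: fsbigTE => i iF.
by have [->//|/pF] := eqVneq (p i) 0; rewrite (negbTE iF).
Qed.

End finite_sums.

Section gentle_partition.
Context {R : realType} {M : metricType R} (A : set M) {I : choiceType}.
Implicit Types (z : I -> A) (p : M -> I -> R).

(** Lee and Naor's gentle partitions of unity, in a discrete form: the variation
    of the coefficients is required only between points that are close on the
    scale of their distance to [A]; averaging handles the other pairs. *)
Definition gentle_partition z p (K delta B : R) :=
  forall x, 0 < set_dist A x ->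
  [/\ finite_set [set i | p x i != 0],
      forall i, 0 <= p x i,
      \sum_(i \in [set: I]) p x i = 1,
      forall i, p x i != 0 -> mdist x (\val (z i)) <= K * set_dist A x
    & forall y, mdist x y <= delta * set_dist A x ->
        \sum_(i \in [set: I]) `|p x i - p y i|
          <= B * (mdist x y / set_dist A x)].

End gentle_partition.

Section averaged_extension.
Context {R : realType} {M : metricType R} {A : set M} (a : A).
Context {I : choiceType} {z : I -> A} {p : M -> I -> R} {K delta B : R}.
Context {X : completeNormedModType R}.
Hypothesis K_ge0 : 0 <= K.
Hypothesis delta_gt0 : 0 < delta.
Hypothesis delta_lt1 : delta < 1.
Hypothesis B_ge0 : 0 <= B.
Hypothesis gp : gentle_partition A z p K delta B.

Let near_point (x : M) (k : nat) : A :=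
  projT1 (cid (set_dist_adherent A a x k.+1%:R^-1 ltac:(by rewrite invr_gt0))).

Let near_pointP (x : M) k :
  mdist x (\val (near_point x k)) < set_dist A x + k.+1%:R^-1.
Proof. by rewrite /near_point; case: cid. Qed.

(** At positive distance from [A] this is an average of [f]; at distance [0] it is
    the limit of [f] along a sequence of [A] that tends to [x], which covers at
    once the points of [A] and those of its closure. *)
Definition averaged_extension (f : A -> X) (x : M) : X :=
  if set_dist A x == 0 then lim (f (near_point x k) @[k --> \oo])
  else \sum_(i \in [set: I]) p x i *: f (z i).

Lemma near_point_cvg (f : Lip A X) (x : M) : set_dist A x = 0 ->
  cvg (f (near_point x k) @[k --> \oo]).
Proof.
move=> x0; apply/cauchy_cvgP/cauchy_exP => e e0.
pose L := lip_seminorm f + 1.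
have L0 : 0 < L by rewrite /L ltr_wpDl// lip_seminorm_ge0.
have eL0 : 0 < e / (2 * L) by rewrite divr_gt0// mulr_gt0.
have [N _ Ne] := near_infty_natSinv_lt (PosNum eL0).
have xnear k : (N <= k)%N -> mdist x (\val (near_point x k)) < e / (2 * L).
  by move=> /Ne /=; apply: lt_trans; have := near_pointP x k; rewrite x0 add0r.
exists (f (near_point x N)); exists N => // k /= Nk.
rewrite -ball_normE /=; apply: le_lt_trans (lip_dist_le f _ _) _.
have dNk : mdist (near_point x N) (near_point x k) < e / L.
  have -> : e / L = e / (2 * L) + e / (2 * L) by field; rewrite gt_eqF.
  apply: le_lt_trans (metric_triangle (\val (near_point x N)) x _) _.
  by rewrite metric_sym ltrD// xnear.
have : L * mdist (near_point x N) (near_point x k) < e.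
  by rewrite mulrC -ltr_pdivlMr.
apply: le_lt_trans; rewrite ler_wpM2r ?mdist_ge0//.
by rewrite /L lerDl.
Qed.

Lemma averaged_extension_linear (k : R) (f g : Lip A X) (x : M) :
  averaged_extension (k *: f + g : Lip A X) x =
  k *: averaged_extension f x + averaged_extension g x.
Proof.
rewrite /averaged_extension; case: eqP => [x0|/eqP x0].
  apply: cvg_lim => //.
  apply: cvgD; last exact: near_point_cvg.
  by apply: cvgZr; exact: near_point_cvg.
have [fin _ _ _ _] := gp x ltac:(by rewrite lt_neqAle eq_sym x0 set_dist_ge0).
have pF i : p x i != 0 -> i \in fset_set [set i | p x i != 0].
  by move=> pi; rewrite in_fset_set// inE.
rewrite !(fsum_scaleE _ _ _ pF) scaler_sumr -big_split /=.
by apply: eq_bigr => i _; rewrite scalerDr !scalerA mulrC.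
Qed.

Let r := set_dist A.

(** Every node used at [x] lies within [K * r x <= K * mdist x y] of [x].  This
    bound contains the extension property, as the case where [x] is the point [y]
    itself. *)
Lemma averaged_extension_dist_le (f : Lip A X) (x : M) (y : A) :
  `|averaged_extension f x - f y|
    <= (K + 1) * lip_seminorm f * mdist x (\val y).
Proof.
have L0 := lip_seminorm_ge0 f.
rewrite /averaged_extension; case: eqP => [x0|/eqP x0].
  have /cvg_ex [l fl] := near_point_cvg f x x0.
  rewrite (cvg_lim _ fl)//.
  suff : `|l - f y| <= lip_seminorm f * mdist x (\val y).
    move=> /le_trans; apply; rewrite ler_wpM2r ?mdist_ge0//.
    by rewrite mulrDl mul1r lerDr mulr_ge0.
  apply/ler_addgt0Pr => e e0.
  have eL0 : 0 < e / (lip_seminorm f + 1) by rewrite divr_gt0// ltr_wpDl.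
  set d := e / _ in eL0.
  have /cvgrPdist_lt/(_ _ eL0)[N _ Nl] := fl.
  have [N' _ Nd] := near_infty_natSinv_lt (PosNum eL0).
  have {Nl} := Nl (maxn N N') (leq_maxl _ _).
  have {Nd} := Nd (maxn N N') (leq_maxr _ _).
  have := near_pointP x (maxn N N'); rewrite /= x0 add0r.
  move: (near_point _ _) => u /lt_trans/[apply] xu lu.
  have -> : e = d + lip_seminorm f * d by rewrite /d; field; rewrite gt_eqF// ltr_wpDl.
  have uy := metric_triangle (\val u) x (\val y); rewrite (metric_sym _ x) in uy.
  have := lip_dist_le f u y => /le_trans/(_ (ler_wpM2l L0 uy)) fuy.
  have := ler_distD (f u) l (f y).
  have := ler_wpM2l L0 (ltW xu).
  rewrite mulrDr in fuy.
  lra.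
have r0 : 0 < r x by rewrite lt_neqAle eq_sym x0 set_dist_ge0.
have [fin p0 p1 pK _] := gp x r0.
have pF i : p x i != 0 -> i \in fset_set [set i | p x i != 0].
  by move=> pi; rewrite in_fset_set// inE.
rewrite (fsum_scaleE _ _ _ pF); rewrite (fsumE _ _ pF) in p1.
have -> : f y = \sum_(i <- fset_set [set i | p x i != 0]) p x i *: f y.
  by rewrite -scaler_suml p1 scale1r.
rewrite -sumrB.
rewrite -[leRHS]mul1r -[X in X * (_ * _ * _)]p1 mulr_suml.
apply: le_trans (ler_norm_sum _ _ _) _; apply: ler_sum => i _.
rewrite -scalerBr normrZ ger0_norm//.
have [->|/pK di] := eqVneq (p x i) 0; first by rewrite !mul0r.
rewrite ler_wpM2l//; apply: le_trans (lip_dist_le f _ _) _.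
rewrite [_ * lip_seminorm f]mulrC -mulrA ler_wpM2l//.
have := metric_triangle (\val (z i)) x (\val y).
rewrite (metric_sym _ x) => /le_trans; apply.
rewrite mulrDl mul1r lerD2r; apply: le_trans di _.
by rewrite ler_wpM2l// set_dist_le.
Qed.

Lemma averaged_extension_val (f : Lip A X) (y : A) :
  averaged_extension f (\val y) = f y.
Proof.
apply/subr0_eq/normr0_eq0/le_anti; rewrite normr_ge0 andbT.
by have := averaged_extension_dist_le f (\val y) y; rewrite mdistxx mulr0.
Qed.

(** Passing through a point of [A] within [2 * r x] of [x] costs only
    [O(r x) <= O(mdist x y / delta)]. *)
Lemma averaged_extension_far (f : Lip A X) (x y : M) :
  0 < r x -> delta * r x < mdist x y ->
  `|averaged_extension f x - averaged_extension f y|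
    <= (K + 1) * (4 / delta + 1) * lip_seminorm f * mdist x y.
Proof.
move=> x0 xy; have [u xu] := set_dist_adherent A a x (r x) x0.
have L0 := lip_seminorm_ge0 f.
apply: le_trans (ler_distD (f u) _ _) _.
have H1 := averaged_extension_dist_le f x u.
have H2 := averaged_extension_dist_le f y u.
rewrite [X in _ + X]distrC; apply: le_trans (lerD H1 H2) _; rewrite -mulrDr.
rewrite -!mulrA ler_wpM2l ?addr_ge0// (mulrCA _ (lip_seminorm f)) ler_wpM2l//.
have := metric_triangle y x (\val u); rewrite (metric_sym y x).
suff : 4 * r x <= 4 / delta * mdist x y by move: xu; rewrite -/(r x); lra.
rewrite mulrAC ler_pdivlMr// -mulrA ler_wpM2l// mulrC; exact: ltW.
Qed.

(** As the coefficients sum to [1], subtracting the constant [f u] does not change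
    the difference of the averages; every node used at [x] or at [y] is then
    within [(2 * K + 4) * r x] of [u]. *)
Lemma averaged_extension_near (f : Lip A X) (x y : M) :
  0 < r x -> mdist x y <= delta * r x ->
  `|averaged_extension f x - averaged_extension f y|
    <= (2 * K + 4) * B * lip_seminorm f * mdist x y.
Proof.
move=> x0 xy; have L0 := lip_seminorm_ge0 f.
have yx1 : mdist x y <= r x.
  by rewrite (le_trans xy)// ler_piMl// ltW.
have y0 : 0 < r y.
  have := set_dist_triangle A a x y; rewrite -/(r x) -/(r y).
  suff : mdist x y < r x by lra.
  by rewrite (le_lt_trans xy)// gtr_pMl.
have ryx : r y <= 2 * r x.
  have := set_dist_triangle A a y x; rewrite -/(r x) -/(r y) metric_sym; lra.
have [u xu] := set_dist_adherent A a x (r x) x0.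
have [finx px0 px1 pxK pxB] := gp x x0.
have [finy py0 py1 pyK _] := gp y y0.
pose F := fset_set ([set i | p x i != 0] `|` [set i | p y i != 0]).
have inF i : i \in F = (p x i != 0) || (p y i != 0).
  rewrite in_fset_set ?finite_setU//; apply/idP/idP.
    by rewrite inE => -[/= ->|/= ->]; rewrite ?orbT.
  by move=> /orP xyi; rewrite inE.
have xF i : p x i != 0 -> i \in F by rewrite inF => ->.
have yF i : p y i != 0 -> i \in F by rewrite inF orbC => ->.
have xyF i : `|p x i - p y i| != 0 -> i \in F.
  rewrite inF -negb_and; apply: contra => /andP[/eqP-> /eqP->].
  by rewrite subrr normr0.
have {pxB} := pxB y xy; rewrite (fsumE _ _ xyF) => pB.
rewrite (fsumE _ _ xF) in px1; rewrite (fsumE _ _ yF) in py1.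
rewrite /averaged_extension !gt_eqF//.
rewrite (fsum_scaleE _ _ _ xF) (fsum_scaleE _ _ _ yF) -sumrB.
have -> : \sum_(i <- F) (p x i *: f (z i) - p y i *: f (z i)) =
          \sum_(i <- F) (p x i - p y i) *: (f (z i) - f u).
  under [RHS]eq_bigr do rewrite scalerBr.
  have s0 : \sum_(i <- F) (p x i - p y i) = 0 by rewrite sumrB px1 py1 subrr.
  rewrite [RHS]sumrB -scaler_suml s0 scale0r subr0.
  by apply: eq_bigr => i _; rewrite scalerBl.
apply: le_trans (ler_norm_sum _ _ _) _.
apply: (@le_trans _ _ (\sum_(i <- F) `|p x i - p y i| *
    (lip_seminorm f * ((2 * K + 4) * r x)))).
  rewrite big_seq [leRHS]big_seq; apply: ler_sum => i.
  rewrite inF => iF; rewrite normrZ ler_wpM2l//.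
  apply: le_trans (lip_dist_le f _ _) _; rewrite ler_wpM2l//.
  have := metric_triangle (\val (z i)) x (\val u); rewrite (metric_sym _ x).
  move=> /le_trans; apply.
  have Kr : 0 <= K * r x by rewrite mulr_ge0// ltW.
  case/orP: iF => [/pxK|/pyK]; rewrite -/(r x) -/(r y) => di.
    by move: xu; rewrite -/(r x); lra.
  have := metric_triangle x y (\val (z i)).
  have : K * r y <= K * (2 * r x) by rewrite ler_wpM2l.
  by move: xu; rewrite -/(r x); lra.
rewrite -mulr_suml; apply: le_trans (ler_wpM2r _ pB) _.
  by rewrite mulr_ge0// mulr_ge0 ?(ltW x0)// addr_ge0// mulr_ge0.
rewrite le_eqVlt; apply/orP; left; apply/eqP; field.
by rewrite gt_eqF.
Qed.

Lemma averaged_extension_lipschitz (f : Lip A X) (x y : M) :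
  `|averaged_extension f x - averaged_extension f y|
    <= ((2 * K + 4) * B + (K + 1) * (4 / delta + 1)) * lip_seminorm f * mdist x y.
Proof.
have L0 := lip_seminorm_ge0 f.
have Ld u v : 0 <= lip_seminorm f * mdist u v by rewrite mulr_ge0// mdist_ge0.
have C1 : 0 <= (2 * K + 4) * B by rewrite mulr_ge0// addr_ge0// mulr_ge0.
have C2 : 0 <= (K + 1) * (4 / delta + 1).
  by rewrite mulr_ge0 ?addr_ge0// divr_ge0// ltW.
wlog: x y / 0 < r x => [H|x0].
  (* Up to exchanging [x] and [y], both distances vanish: then compare with [f]
     at a point of [A] arbitrarily close to [x]. *)
  have [x0|x0] := ltP 0 (r x); first exact: H.
  have [y0|y0] := ltP 0 (r y); first by rewrite distrC metric_sym; exact: H.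
  apply/ler_addgt0Pr => e e0.
  set d := e / ((K + 1) * (2 * (lip_seminorm f + 1))).
  have eL0 : 0 < d.
    by rewrite divr_gt0// mulr_gt0 ?ltr_wpDl// mulr_gt0// ltr_wpDl.
  have [u xu] := set_dist_adherent A a x _ eL0.
  have H1 := averaged_extension_dist_le f x u.
  have H2 := averaged_extension_dist_le f y u.
  apply: le_trans (ler_distD (f u) _ _) _.
  rewrite [X in _ + X]distrC; apply: le_trans (lerD H1 H2) _; rewrite -mulrDr.
  have xue : mdist x (\val u) <= d.
    by rewrite -[leRHS]add0r (le_trans (ltW xu))// lerD2r.
  have := metric_triangle y x (\val u); rewrite (metric_sym y x) => yu.
  have KL : 0 <= (K + 1) * lip_seminorm f by rewrite mulr_ge0// addr_ge0.
  apply: (@le_trans _ _ ((K + 1) * lip_seminorm f * (mdist x y + 2 * d))).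
    by rewrite ler_wpM2l//; lra.
  rewrite mulrDr; apply: lerD.
    rewrite -!mulrA ler_wpM2r//.
    rewrite -[leLHS]mulr1; apply: ler_wpDl => //; rewrite ler_wpM2l ?addr_ge0//.
    by rewrite lerDr divr_ge0// ltW.
  have -> : (K + 1) * lip_seminorm f * (2 * d) =
      e * (lip_seminorm f / (lip_seminorm f + 1)).
    by rewrite /d; field; rewrite !gt_eqF// ltr_wpDl.
  by rewrite ger_pMr// ler_pdivrMr ?ltr_wpDl// mul1r lerDl.
have [xy|xy] := leP (mdist x y) (delta * r x).
  apply: le_trans (averaged_extension_near f x y x0 xy) _.
  by rewrite -mulrA -[leRHS]mulrA ler_wpM2r// lerDl.
apply: le_trans (averaged_extension_far f x y x0 xy) _.
by rewrite -mulrA -[leRHS]mulrA ler_wpM2r// lerDr.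
Qed.

Lemma simultaneous_extension_of_gentle_partition :
  exists E : {linear Lip A X -> Lip M X}, simultaneous_extension E /\
    (ext_norm E <= ((2 * K + 4) * B + (K + 1) * (4 / delta + 1))%:E)%E.
Proof.
apply: (simultaneous_extension_of_lipschitz_operator A X
  (fun f => averaged_extension f)).
- by rewrite addr_ge0// mulr_ge0 ?addr_ge0 ?mulr_ge0 ?invr_ge0// ltW.
- exact: averaged_extension_lipschitz.
- exact: averaged_extension_linear.
- exact: averaged_extension_val.
Qed.

End averaged_extension.

(** * Volumes of balls and separated nets *)

Section doubling_volume.
Context {R : realType} {T : metricType R} {t0 : T}.
Context (mu : {measure set (borelType t0) -> \bar R}).
Hypothesis mu_doubling : is_doubling (mu : set T -> \bar R).

Definition doubling_real : R := fine (doubling_constant (mu : set T -> \bar R)).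
Definition vol (x : T) (r : R) : R := fine (mu (ball x r)).

Let D := doubling_real.

Lemma measurable_ball_borel (x : T) (r : R) :
  measurable (ball x r : set (borelType t0)).
Proof.
apply: sub_sigma_algebra; rewrite openE => y /=.
rewrite ballEmdist /= => xy; rewrite /interior.
apply/nbhs_ballP; exists (r - mdist x y); first by rewrite /= subr_gt0.
move=> u; rewrite !ballEmdist /= => yu.
by have := metric_triangle x y u; lra.
Qed.

Lemma mu_ballE (x : T) (r : R) : 0 < r -> mu (ball x r) = (vol x r)%:E.
Proof.
move=> r0; have [m0 moo] := mu_doubling.1 x r r0.
by rewrite /vol fineK// fin_numE gt_eqF ?lt_eqF// (lt_trans _ m0)// ltNyr.
Qed.

Lemma vol_gt0 (x : T) (r : R) : 0 < r -> 0 < vol x r.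
Proof.
by move=> r0; have [+ _] := mu_doubling.1 x r r0; rewrite mu_ballE// lte_fin.
Qed.

Lemma vol_le (x y : T) (r s : R) : 0 < r -> 0 < s -> mdist x y + r <= s ->
  vol x r <= vol y s.
Proof.
move=> r0 s0 xyrs; rewrite -lee_fin -!mu_ballE//.
apply: le_measure; rewrite ?inE; try exact: measurable_ball_borel.
move=> u; rewrite !ballEmdist /= => xu.
by have := metric_triangle y x u; rewrite (metric_sym y x); lra.
Qed.

Lemma doubling_constantE : doubling_constant (mu : set T -> \bar R) = D%:E.
Proof.
have [_ Doo] := mu_doubling; rewrite /D /doubling_real fineK// fin_numE.
rewrite (lt_eqF Doo) andbT gt_eqF//; apply: lt_le_trans (ereal_sup_ubound _); last first.
  by exists t0, 1; split; [exact: ltr01|reflexivity].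
rewrite !mu_ballE ?mulr_gt0// /=.
by rewrite inver gt_eqF ?vol_gt0// -EFinM ltNyr.
Qed.

Lemma vol_double (x : T) (r : R) : 0 < r -> vol x (2 * r) <= D * vol x r.
Proof.
move=> r0; rewrite -ler_pdivrMr ?vol_gt0// -lee_fin -doubling_constantE.
apply: ereal_sup_ubound; exists x, r; split => //.
by rewrite !mu_ballE ?mulr_gt0// inver gt_eqF ?vol_gt0.
Qed.

Lemma doubling_real_ge1 : 1 <= D.
Proof.
have := vol_double t0 1 ltr01.
have : vol t0 1 <= vol t0 (2 * 1) by apply: vol_le; rewrite ?mdistxx//; lra.
move=> /le_trans/[apply]; rewrite ler_pMl// vol_gt0//.
Qed.

(** The form in which doubling is used: comparable balls have comparable volumes,
    up to a power of the doubling constant. *)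
Lemma vol_le_pow (x y : T) (r s : R) (k : nat) : 0 < r -> 0 < s ->
  mdist x y + r <= 2 ^+ k * s -> vol x r <= D ^+ k * vol y s.
Proof.
move=> r0 s0 xys; apply: (@le_trans _ _ (vol y (2 ^+ k * s))).
  by apply: vol_le => //; rewrite mulr_gt0// exprn_gt0.
elim: k {xys} => [|k IH]; first by rewrite !expr0 !mul1r.
rewrite !exprS -!mulrA; apply: le_trans (vol_double _ _ _) _.
  by rewrite mulr_gt0// exprn_gt0.
by rewrite ler_wpM2l// (le_trans _ doubling_real_ge1).
Qed.

(** Maximality is imposed on the disjointness of the balls of radius [s / 2], which
    is what the volume bounds use; it still forces the points to be [s]-dense. *)
Definition net (s : R) : set T := projT1 (cid (ex_intro _ _ (projT2
  (ex_maximal_disjoint_subcollection (fun x : T => ball x (s / 2)) setT)))).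

Lemma netP (s : R) :
  maximal_disjoint_subcollection (fun x : T => ball x (s / 2)) (net s) setT.
Proof. by rewrite /net; case: cid. Qed.

(** A point at distance at least [s] from the net could be added to it. *)
Lemma net_cover (s : R) (x : T) : 0 < s -> exists2 z, net s z & mdist x z < s.
Proof.
move=> s0; have [_ disj maxi] := netP s.
apply: contrapT => nex.
have far z : net s z -> s <= mdist x z.
  by move=> zs; rewrite leNgt; apply/negP => xz; apply: nex; exists z.
have nx : ~ net s x by move=> /far; rewrite mdistxx leNgt s0.
have sep z : net s z -> ball x (s / 2) `&` ball z (s / 2) !=set0 -> False.
  move=> /far xz [u]; rewrite !ballEmdist/= => -[xu zu].
  by have := metric_triangle x u z; rewrite (metric_sym u); lra.
apply: (maxi (x |` net s)) => //.
  by split=> [u|sub]; [right|apply: nx; apply: sub; left].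
move=> u v [->|us] [->|vs] uv //.
- by have := sep _ vs uv.
- by exfalso; apply: (sep _ us); rewrite setIC.
- exact: disj uv.
Qed.

(** The balls of radius [s / 2] around points of the net are disjoint. *)
Lemma sum_vol_net_le (s : R) (F : seq T) (x : T) (r : R) : 0 < s -> 0 < r ->
  uniq F -> (forall z, z \in F -> net s z /\ mdist z x + s / 2 <= r) ->
  \sum_(z <- F) vol z (s / 2) <= vol x r.
Proof.
move=> s0 r0 uF HF; have [_ disj _] := netP s.
have s20 : 0 < s / 2 by rewrite divr_gt0.
rewrite -lee_fin -sumEFin -mu_ballE//.
under eq_bigr do rewrite -mu_ballE//.
have mF z : [set` F] z -> measurable (ball z (s / 2) : set (borelType t0)).
  by move=> _; exact: measurable_ball_borel.
have dF : trivIset [set` F] (fun z => ball z (s / 2) : set (borelType t0)).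
  by move=> u v /HF[us _] /HF[vs _]; exact: disj.
rewrite fsbig_seq//.
rewrite -(measure_fin_bigcup mu (finite_seq F) dF mF).
apply: le_measure; rewrite ?inE.
- by apply: fin_bigcup_measurable; [exact: finite_seq|exact: mF].
- exact: measurable_ball_borel.
move=> u [z /= /HF[_ zx]]; rewrite !ballEmdist /= => zu.
by have := metric_triangle x z u; rewrite (metric_sym x z); lra.
Qed.

End doubling_volume.

(** * Elementary estimates *)

Lemma int_window (j k : int) : j - 2 < k -> k < j + 3 ->
  k \in [:: j - 1; j; j + 1; j + 2].
Proof. by rewrite !inE; lia. Qed.

Section exponential_estimates.
Context {R : realType}.
Implicit Types x y t : R.

Lemma expR1_ge2 : 2 <= expR 1 :> R.
Proof. by have := expR_ge1Dx (1 : R); lra. Qed.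

Lemma expR1_le4 : expR 1 <= 4 :> R.
Proof.
have h : 1 / 2 <= expR (- (1 / 2)) :> R by have := expR_ge1Dx (- (1 / 2) : R); lra.
have e : expR (1 / 2) * expR (- (1 / 2)) = 1 :> R := expRxMexpNx_1 (1 / 2).
have -> : (1 : R) = 1 / 2 + 1 / 2 by field.
by rewrite expRD; have := expR_gt0 (1 / 2 : R); nra.
Qed.

Lemma expRN_dist_le x y t : `|x - y| <= t -> t <= 1 ->
  `|expR (- x) - expR (- y)| <= 4 * t * expR (- x).
Proof.
move=> /[dup] xyt; rewrite ler_norml => /andP[xyt1 xyt2] t1.
have -> : expR (- y) = expR (- x) * expR (x - y) by rewrite -expRD; congr expR; ring.
rewrite -[X in `|X - _|]mulr1 -mulrBr normrM (gtr0_norm (expR_gt0 _)) mulrC.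
rewrite ler_wpM2r ?expR_ge0// ler_norml.
have t0 : 0 <= t by apply: le_trans xyt.
have h1 := expR_ge1Dx (x - y).
have h2 : expR (x - y) <= expR t by rewrite ler_expR.
have h3 : expR t <= 4 by apply: le_trans expR1_le4; rewrite ler_expR.
have h4 : expR t * expR (- t) = 1 := expRxMexpNx_1 t.
have h5 := expR_ge1Dx (- t).
have h6 : expR t - 1 <= 4 * t by have := expR_gt0 t; nra.
by apply/andP; split; lra.
Qed.

Lemma ln_sub_le x y : 0 < x -> 0 < y -> ln x - ln y <= (x - y) / y.
Proof.
move=> x0 y0; rewrite -ln_div ?posrE//.
have -> : x / y = 1 + (x - y) / y by field; rewrite gt_eqF.
apply: le_ln1Dx; rewrite -subr_gt0.
by have -> : (x - y) / y - -1 = x / y by [field; rewrite gt_eqF|]; rewrite divr_gt0.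
Qed.

(** The [i]-th term is at most
    [`|u i - v i| / U + v i * `|V - U| / (U * V)], and [`|V - U|] is itself at most
    the sum of the [`|u k - v k|]. *)
Lemma normalized_sum_dist_le (I : eqType) (F : seq I) (u v : I -> R) :
  (forall i, 0 <= v i) -> 0 < \sum_(i <- F) u i -> 0 < \sum_(i <- F) v i ->
  \sum_(i <- F) `|u i / (\sum_(k <- F) u k) - v i / (\sum_(k <- F) v k)|
    <= 2 * (\sum_(i <- F) `|u i - v i|) / (\sum_(k <- F) u k).
Proof.
move=> v0; set U := \sum_(i <- F) u i; set V := \sum_(i <- F) v i => U0 V0.
set S := \sum_(i <- F) `|u i - v i|.
have UV : `|V - U| <= S.
  by rewrite distrC /U /V -sumrB; exact: ler_norm_sum.
apply: (@le_trans _ _ (\sum_(i <- F) (`|u i - v i| / U + v i * (S / (U * V))))).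
  apply: ler_sum => i _.
  have -> : u i / U - v i / V = (u i - v i) / U + v i * ((V - U) / (U * V)).
    by field; rewrite !gt_eqF.
  apply: le_trans (ler_normD _ _) _.
  rewrite normrM normfV (gtr0_norm U0) lerD2l normrM (ger0_norm (v0 i)).
  rewrite ler_wpM2l// normrM normfV (gtr0_norm (mulr_gt0 U0 V0)).
  by rewrite ler_wpM2r// invr_ge0 ltW// mulr_gt0.
rewrite big_split /= -!mulr_suml -/S -/V le_eqVlt; apply/orP; left; apply/eqP.
by field; rewrite !gt_eqF.
Qed.

Lemma max0_dist_le x y : `|Num.max 0 x - Num.max 0 y| <= `|x - y|.
Proof.
have [x0|x0] := lerP x 0; have [y0|y0] := lerP y 0.
- by rewrite subrr normr0.
- by rewrite ler0_norm ?ler0_norm; lra.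
- by rewrite ger0_norm ?ger0_norm; lra.
- by [].
Qed.

(** The same bound for families with finite support, which are normalized by their
    total sum; the two supports may differ. *)
Lemma normalized_fsum_dist_le (I : choiceType) (F : {fset I}) (u v : I -> R) :
  (forall i, u i != 0 -> i \in F) -> (forall i, v i != 0 -> i \in F) ->
  (forall i, 0 <= v i) ->
  0 < \sum_(i \in [set: I]) u i -> 0 < \sum_(i \in [set: I]) v i ->
  \sum_(i \in [set: I]) `|u i / (\sum_(k \in [set: I]) u k)
                        - v i / (\sum_(k \in [set: I]) v k)|
    <= 2 * (\sum_(i <- F) `|u i - v i|) / (\sum_(k \in [set: I]) u k).
Proof.
move=> uF vF v0; rewrite (fsumE _ _ uF) (fsumE _ _ vF) => U0 V0.
rewrite (fsumE _ F) => [|i]; first exact: normalized_sum_dist_le.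
apply: contraR => iF.
have -> : u i = 0 by apply/eqP; apply: contraR iF; exact: uF.
have -> : v i = 0 by apply/eqP; apply: contraR iF; exact: vF.
by rewrite !mul0r subrr normr0.
Qed.

End exponential_estimates.

(** * The partition by truncated exponential weights *)

Section exponential_partition.
Context {R : realType} {M : metricType R} {A : set M} {a : A}.
Context (mu : {measure set (borelType a) -> \bar R}).
Hypothesis mu_doubling : is_doubling (mu : set A -> \bar R).

Local Notation r := (set_dist A).
Let D : R := doubling_real mu.
Context (n : R).
Hypothesis n_ge : ln D + 1 <= n.

Definition scale (j : int) : R := expR j%:~R.

Definition mass (i : A * int) : R := vol mu i.1 (scale i.2 / 2).

(** The second term vanishes when [ln (r x)] is within [1] of the level of [i] and
    exceeds [17] when it is not within [2]: levels enter and leave the weights at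
    a controlled rate, with no separate interpolation between scales. *)
Definition spread (x : M) (i : A * int) : R :=
  mdist x (\val i.1) / r x + 17 * Num.max 0 (`|ln (r x) - i.2%:~R| - 1).

Definition is_node : set (A * int) := [set i | net (scale i.2) i.1].

(** Subtracting [exp (- 16 * n)] makes the exponential weight vanish continuously
    at spread [16]. *)
Definition node_weight (x : M) (i : A * int) : R :=
  if `[< is_node i >] then
    mass i * Num.max 0 (expR (- (n * spread x i)) - expR (- (n * 16)))
  else 0.

(** The threshold is [17], and not [16], in order that the nodes in use at points
    close to [x] be near nodes of [x]. *)
Definition near_nodes (x : M) : set (A * int) :=
  [set i | is_node i /\ spread x i < 17].

Let D_ge1 : 1 <= D := doubling_real_ge1 mu mu_doubling.

Let n_ge1 : 1 <= n.
Proof. by apply: le_trans n_ge; rewrite lerDr ln_ge0. Qed.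

Let scale_gt0 j : 0 < scale j. Proof. exact: expR_gt0. Qed.

Lemma mass_gt0 i : 0 < mass i.
Proof. by apply: vol_gt0 => //; rewrite divr_gt0. Qed.

Lemma mdist_le_spread (x : M) i : 0 < r x -> mdist x (\val i.1) <= spread x i * r x.
Proof.
move=> x0; rewrite -ler_pdivrMr// /spread lerDl mulr_ge0// le_max lexx //.
Qed.

Lemma near_level (x : M) i : 0 < r x -> spread x i < 17 ->
  `|ln (r x) - i.2%:~R| < 2.
Proof.
move=> x0 xi.
have : 0 <= mdist x (\val i.1) / r x by rewrite divr_ge0 ?mdist_ge0// ltW.
have : `|ln (r x) - i.2%:~R| - 1 <= Num.max 0 (`|ln (r x) - i.2%:~R| - 1).
  by rewrite le_max lexx orbT.
by move: xi; rewrite /spread; lra.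
Qed.

Lemma near_scale (x : M) i : 0 < r x -> spread x i < 17 ->
  scale i.2 <= 16 * r x /\ r x <= 16 * scale i.2.
Proof.
move=> x0 xi.
have := near_level x i x0 xi.
rewrite ltr_norml => /andP[h1 h2].
have e2 : expR 2 <= 16 :> R.
  have -> : (2 : R) = 1 + 1 by ring.
  by rewrite expRD; have := @expR1_le4 R; have := expR_gt0 (1 : R); nra.
have key (u v : R) : v - u <= 2 -> expR v <= 16 * expR u.
  move=> uv; have -> : v = (v - u) + u by ring.
  by rewrite expRD ler_wpM2r ?expR_ge0// (le_trans _ e2)// ler_expR; lra.
rewrite -[r x]lnK ?posrE// /scale; split; apply: key; lra.
Qed.

(** A net point of level [floor (ln (r x))] close to a nearly nearest point of
    [A]; all other masses are compared with the mass of such a node. *)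
Lemma base_node (x : M) : 0 < r x -> exists i0 : A * int,
  [/\ is_node i0, spread x i0 < 3, scale i0.2 <= r x, r x <= 4 * scale i0.2 &
      i0.2 = Num.floor (ln (r x))].
Proof.
move=> x0; set j := Num.floor (ln (r x)).
have j1 : j%:~R <= ln (r x) by exact: floor_le.
have j2 : ln (r x) < j%:~R + 1.
  by have := real_floorD1_gt (num_real (ln (r x))); rewrite intrD.
have s1 : scale j <= r x by rewrite -[leRHS]lnK ?posrE// ler_expR.
have s2 : r x <= 4 * scale j.
  rewrite -[leLHS]lnK ?posrE//; apply: (@le_trans _ _ (expR (j%:~R + 1))).
    by rewrite ler_expR ltW.
  by rewrite expRD mulrC ler_wpM2r ?expR_ge0// expR1_le4.
have [u xu] := set_dist_adherent A a x (r x) x0.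
have [z zn uz] := net_cover _ u (scale_gt0 j).
exists (z, j); split => //=.
rewrite /spread /=.
have -> : Num.max 0 (`|ln (r x) - j%:~R| - 1) = 0.
  by apply/max_idPl; rewrite subr_le0 ger0_norm; lra.
rewrite mulr0 addr0 ltr_pdivrMr//.
have := metric_triangle x (\val u) (\val z).
by have : mdist (\val u) (\val z) = mdist u z by []; lra.
Qed.

(** The near nodes of [x] occupy four levels.  In each level their balls are
    disjoint and lie in the ball of radius [28 * r x] around the base node, where
    [28 = 17 + 3 + 8] and [28 * r x <= 2 ^+ 8 * (scale i0.2 / 2)]. *)
Lemma sum_mass_le (x : M) (i0 : A * int) (F : {fset A * int}) :
  0 < r x -> spread x i0 < 3 ->
  r x <= 4 * scale i0.2 -> i0.2 = Num.floor (ln (r x)) ->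
  (forall i, i \in F -> near_nodes x i) ->
  \sum_(i <- F) mass i <= 4 * (D ^+ 8 * mass i0).
Proof.
move=> x0 xi0 xs0 j0E HF; set j0 := i0.2.
have xz0 := mdist_le_spread x i0 x0.
have {}xz0 : mdist x (\val i0.1) <= 3 * r x.
  by apply: le_trans xz0 _; rewrite ler_wpM2r ?ltW.
pose s : seq int := [:: j0 - 1; j0; j0 + 1; j0 + 2].
have levels i : i \in F -> i.2 \in s.
  move=> /HF[_ xi].
  have := near_level x i x0 xi.
  rewrite ltr_norml => /andP[h1 h2].
  have j1 : j0%:~R <= ln (r x) by rewrite /j0 j0E; exact: floor_le.
  have j2 : ln (r x) < j0%:~R + 1.
    by have := real_floorD1_gt (num_real (ln (r x))); rewrite -j0E intrD.
  have k1 : j0 - 2 < i.2.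
    by rewrite -(ltr_int R) intrB; lra.
  have k2 : i.2 < j0 + 3.
    by rewrite -(ltr_int R) intrD; lra.
  by apply: int_window.
apply: (@le_trans _ _ (\sum_(k <- s) \sum_(i <- F | i.2 == k) mass i)).
  rewrite (exchange_big_dep predT)//= big_seq [leRHS]big_seq.
  apply: ler_sum => i iF.
  rewrite (big_rem _ (levels i iF)) /= eqxx lerDl sumr_ge0// => *.
  exact/ltW/mass_gt0.
apply: (@le_trans _ _ (\sum_(k <- s) (D ^+ 8 * mass i0))); last first.
  by rewrite /s !big_cons big_nil le_eqVlt; apply/orP; left; apply/eqP; ring.
apply: ler_sum => k _.
have -> : \sum_(i <- F | i.2 == k) mass i =
          \sum_(z <- [seq i.1 | i <- F & i.2 == k]) vol mu z (scale k / 2).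
  by rewrite big_map big_filter; apply: eq_bigr => i /eqP <-.
apply: le_trans (vol_le_pow mu mu_doubling i0.1 i0.1 (28 * r x) (scale j0 / 2) 8 _ _ _).
- apply: sum_vol_net_le => //; first by rewrite mulr_gt0.
    rewrite map_inj_in_uniq ?filter_uniq ?fset_uniq//.
    move=> [u1 u2] [v1 v2]; rewrite !mem_filter /=.
    by move=> /andP[/eqP-> _] /andP[/eqP-> _] ->.
  move=> z /mapP[i]; rewrite mem_filter => /andP[/eqP ik /HF[iN xi]] ->.
  split; first by move: iN; rewrite /is_node /= ik.
  have [] := near_scale x i x0 xi; rewrite ik => sk _.
  have := mdist_le_spread x i x0.
  have : spread x i * r x <= 17 * r x by rewrite ler_wpM2r// ltW.
  have := metric_triangle (\val i.1) x (\val i0.1); rewrite (metric_sym _ x).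
  by have : mdist (\val i.1) (\val i0.1) = mdist i.1 i0.1 by []; lra.
- by rewrite mulr_gt0.
- by rewrite divr_gt0.
- rewrite mdistxx add0r.
  have -> : 2 ^+ 8 * (scale j0 / 2) = 128 * scale j0 by field.
  by have : 0 < scale j0 by []; move: xs0; rewrite -/j0; lra.
Qed.

Lemma mass_lower (x : M) (i0 i : A * int) : 0 < r x ->
  spread x i0 < 3 -> scale i0.2 <= r x -> near_nodes x i ->
  mass i0 <= D ^+ 10 * mass i.
Proof.
move=> x0 xi0 s0 [_ xi]; apply: vol_le_pow => //; rewrite ?divr_gt0//.
have [_ sk] := near_scale x i x0 xi.
have h1 := mdist_le_spread x i x0; have h2 := mdist_le_spread x i0 x0.
have h3 : spread x i * r x <= 17 * r x by rewrite ler_wpM2r// ltW.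
have h4 : spread x i0 * r x <= 3 * r x by rewrite ler_wpM2r// ltW.
have -> : 2 ^+ 10 * (scale i.2 / 2) = 512 * scale i.2 by field.
have := metric_triangle (\val i0.1) x (\val i.1); rewrite (metric_sym _ x).
by have : mdist (\val i0.1) (\val i.1) = mdist i0.1 i.1 by []; lra.
Qed.

(** The near nodes have bounded total mass, and each has at least a fixed fraction
    of the mass of the base node. *)
Lemma finite_near_nodes (x : M) : 0 < r x -> finite_set (near_nodes x).
Proof.
move=> x0; have [i0 [nd xi0 s0 xs0 jE]] := base_node x x0.
apply: contrapT => inf.
pose N := (Num.truncn (4 * D ^+ 18)).+1.
have [F FN cF] := infinite_set_fset N inf.
have HF i : i \in F -> near_nodes x i by move=> iF; apply: FN.
have D0 : 0 < D by apply: lt_le_trans D_ge1.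
have up := sum_mass_le x i0 F x0 xi0 xs0 jE HF.
have low : mass i0 *+ #|`F| <= D ^+ 10 * \sum_(i <- F) mass i.
  have -> : mass i0 *+ #|`F| = \sum_(i <- F) mass i0.
    by rewrite big_const_seq count_predT iter_addr_0.
  rewrite mulr_sumr big_seq [leRHS]big_seq.
  by apply: ler_sum => i /HF; exact: mass_lower.
have := le_trans low (ler_wpM2l (exprn_ge0 10 (ltW D0)) up).
have -> : D ^+ 10 * (4 * (D ^+ 8 * mass i0)) = (4 * D ^+ 18) * mass i0 by ring.
rewrite -[_ *+ #|`F|]mulr_natl ler_pM2r ?mass_gt0//; apply/negP; rewrite -ltNge.
apply: lt_le_trans (real_truncnS_gt (num_real _)) _.
by rewrite ler_nat.
Qed.

Lemma near_nodesP (x : M) i : 0 < r x ->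
  reflect (near_nodes x i) (i \in fset_set (near_nodes x)).
Proof.
move=> x0; rewrite in_fset_set; last exact: finite_near_nodes.
by apply: (iffP idP); rewrite inE.
Qed.

Lemma node_weight_ge0 (x : M) i : 0 <= node_weight x i.
Proof.
rewrite /node_weight; case: ifP => // _.
by rewrite mulr_ge0 ?(ltW (mass_gt0 i))// le_max lexx.
Qed.

Lemma node_weight_eq0 (x : M) i : ~ is_node i \/ 16 <= spread x i ->
  node_weight x i = 0.
Proof.
rewrite /node_weight => -[nN|xi]; first by rewrite asboolF.
case: ifP => // _; rewrite (_ : Num.max _ _ = 0) ?mulr0//.
apply/max_idPl; rewrite subr_le0 ler_expR lerN2 ler_wpM2l//.
exact: le_trans n_ge1.
Qed.

Lemma exp_mass_le (x : M) i : is_node i ->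
  mass i * expR (- (n * spread x i)) <=
  node_weight x i + expR (- (n * 16)) * mass i.
Proof.
move=> iN; rewrite /node_weight asboolT// [_ * mass i]mulrC -mulrDr.
rewrite ler_wpM2l ?(ltW (mass_gt0 i))//.
by rewrite -lerBlDr le_max lexx orbT.
Qed.

Let four_D8_le : 4 * D ^+ 8 <= expR (n * 10).
Proof.
have D0 : 0 < D by apply: lt_le_trans D_ge1.
have Dn : D <= expR n.
  by rewrite -[leLHS]lnK ?posrE// ler_expR; apply: le_trans n_ge; rewrite lerDl.
have e2 : 2 <= expR n by rewrite (le_trans expR1_ge2)// ler_expR.
have -> : expR (n * 10) = expR n ^+ 2 * expR n ^+ 8.
  by rewrite -exprD -expRM_natr.
apply: ler_pM; rewrite ?exprn_ge0 ?(ltW D0)//.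
  by rewrite expr2; nra.
by rewrite lerXn2r ?nnegrE ?expR_ge0 ?(ltW D0).
Qed.

(** The exponential masses exceed the weights by at most
    [exp (- 16 * n)] times the total mass of the near nodes, hence by at most
    [exp (- 6 * n)] times the mass of the base node, whose spread is below [3];
    and [exp (- 6 * n) <= exp (- 3 * n) - exp (- 16 * n)]. *)
Lemma sum_exp_mass_le (x : M) : 0 < r x ->
  let F := fset_set (near_nodes x) in
  0 < \sum_(i <- F) node_weight x i /\
  \sum_(i <- F) mass i * expR (- (n * spread x i))
    <= 2 * \sum_(i <- F) node_weight x i.
Proof.
move=> x0 F; have fin := finite_near_nodes x x0.
have [i0 [nd xi0 s0 xs0 jE]] := base_node x x0.
have HF i : i \in F -> near_nodes x i by rewrite in_fset_set// inE.
have i0F : i0 \in F by rewrite in_fset_set// inE; split=> //; lra.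
set W := \sum_(i <- F) node_weight x i.
have m0 := mass_gt0 i0.
have w0W : node_weight x i0 <= W.
  rewrite /W (big_rem _ i0F) /= lerDl sumr_ge0// => *; exact: node_weight_ge0.
have n1 := n_ge1.
have e3 : expR (- (n * 3)) <= 1 / 4.
  have : expR (- (n * 3)) * expR (n * 3) = 1 by rewrite mulrC expRxMexpNx_1.
  have : 4 <= expR (n * 3) by have := expR_ge1Dx (n * 3); lra.
  by have := expR_gt0 (- (n * 3)); nra.
have e6 : expR (- (n * 6)) = expR (- (n * 3)) * expR (- (n * 3)).
  by rewrite -expRD; congr expR; ring.
have e16 : expR (- (n * 16)) <= expR (- (n * 6)) by rewrite ler_expR; lra.
have w0 : expR (- (n * 6)) * mass i0 <= node_weight x i0.
  rewrite /node_weight asboolT// mulrC ler_wpM2l ?(ltW m0)//.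
  rewrite le_max; apply/orP; right.
  have : expR (- (n * 3)) <= expR (- (n * spread x i0)).
    rewrite ler_expR lerN2 ler_wpM2l ?(ltW xi0)//; exact: le_trans n_ge1.
  by have := expR_gt0 (- (n * 3)); nra.
have W0 : 0 < W.
  by apply: lt_le_trans w0W; apply: lt_le_trans w0; rewrite mulr_gt0 ?expR_gt0.
split => //.
apply: (@le_trans _ _ (\sum_(i <- F) (node_weight x i + expR (- (n * 16)) * mass i))).
  rewrite big_seq [leRHS]big_seq; apply: ler_sum => i /HF[iN _].
  exact: exp_mass_le.
rewrite big_split /= -mulr_sumr -/W mulr_natl mulr2n lerD2l.
apply: le_trans w0W; apply: le_trans w0.
have sm := sum_mass_le x i0 F x0 xi0 xs0 jE HF.
apply: le_trans (ler_wpM2l (expR_ge0 _) sm) _.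
rewrite (mulrA 4) mulrA ler_wpM2r ?(ltW m0)//.
apply: le_trans (ler_wpM2l (expR_ge0 _) four_D8_le) _.
by rewrite -expRD ler_expR; lra.
Qed.

(** Both [mdist x z / r x] and [ln (r x)] vary at rate [O(1 / r x)] as long as
    [mdist x z] is [O(r x)], which a bound on one of the two spreads ensures. *)
Lemma spread_dist_le (x y : M) i : 0 < r x -> mdist x y <= r x / 70 ->
  spread x i < 16 \/ spread y i < 16 ->
  `|spread x i - spread y i| <= 70 * (mdist x y / r x).
Proof.
move=> x0 xy xyi; set d := mdist x y.
have d0 : 0 <= d by exact: mdist_ge0.
have r1 := set_dist_triangle A a x y; have r2 := set_dist_triangle A a y x.
rewrite (metric_sym y x) in r2; rewrite -/d in r1 r2 xy.
have y0 : 0 < r y by lra.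
set dx := mdist x (\val i.1); set dy := mdist y (\val i.1).
have t1 : dx <= d + dy by exact: metric_triangle.
have t2 : dy <= d + dx by rewrite /d metric_sym; exact: metric_triangle.
have dx0 : 0 <= dx by exact: mdist_ge0.
have dy0 : 0 <= dy by exact: mdist_ge0.
have e0 : 0 <= d / r x by rewrite divr_ge0// ltW.
have dry : d / r y <= 70 / 69 * (d / r x).
  rewrite ler_pdivrMr//.
  have -> : 70 / 69 * (d / r x) * r y = d * (70 / 69 * r y / r x).
    by field; rewrite gt_eqF.
  by rewrite ler_peMr// ler_pdivlMr//; lra.
have part1 : `|dx / r x - dy / r y| <= 18 * (d / r x).
  have m1 i' z : 0 <= 17 * Num.max 0 (`|ln (r z) - i'%:~R| - 1) :> R.
    by rewrite mulr_ge0// le_max lexx.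
  case: xyi => [xi|yi].
  - have dx16 : dx <= 16 * r x.
      by rewrite -ler_pdivrMr//; have := m1 i.2 x; move: xi; rewrite /spread -/dx; lra.
    apply: (@le_trans _ _ (17 * (d / r y))); last by lra.
    have -> : dx / r x - dy / r y = (dx / r x * (r y - r x) + (dx - dy)) / r y.
      by field; rewrite !gt_eqF.
    rewrite normrM normfV (gtr0_norm y0) mulrA ler_wpM2r ?invr_ge0 ?(ltW y0)//.
    apply: le_trans (ler_normD _ _) _.
    have h : `|dx - dy| <= d by rewrite ler_norml; lra.
    have h' : `|r y - r x| <= d by rewrite ler_norml; lra.
    rewrite normrM ger0_norm ?divr_ge0 ?(ltW x0)//.
    have h2 : dx / r x * `|r y - r x| <= 16 * d.
      by apply: ler_pM => //; rewrite ?divr_ge0 ?(ltW x0)// ler_pdivrMr.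
    by lra.
  - have dy16 : dy <= 16 * r y.
      by rewrite -ler_pdivrMr//; have := m1 i.2 y; move: yi; rewrite /spread -/dy; lra.
    apply: (@le_trans _ _ (17 * (d / r x))); last by lra.
    have -> : dx / r x - dy / r y = ((dx - dy) + dy / r y * (r y - r x)) / r x.
      by field; rewrite !gt_eqF.
    rewrite normrM normfV (gtr0_norm x0) mulrA ler_wpM2r ?invr_ge0 ?(ltW x0)//.
    apply: le_trans (ler_normD _ _) _.
    have h : `|dx - dy| <= d by rewrite ler_norml; lra.
    have h' : `|r y - r x| <= d by rewrite ler_norml; lra.
    rewrite normrM [X in X * _]ger0_norm ?divr_ge0 ?(ltW y0)//.
    have h2 : dy / r y * `|r y - r x| <= 16 * d.
      by apply: ler_pM => //; rewrite ?divr_ge0 ?(ltW y0)// ler_pdivrMr.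
    by lra.
have lnxy : `|ln (r x) - ln (r y)| <= 70 / 69 * (d / r x).
  have l1 := ln_sub_le (r x) (r y) x0 y0; have l2 := ln_sub_le (r y) (r x) y0 x0.
  have q1 : (r x - r y) / r y <= d / r y.
    by rewrite ler_wpM2r ?invr_ge0 ?(ltW y0)//; lra.
  have q2 : (r y - r x) / r x <= d / r x.
    by rewrite ler_wpM2r ?invr_ge0 ?(ltW x0)//; lra.
  by rewrite ler_norml; lra.
have part2 : `|Num.max 0 (`|ln (r x) - i.2%:~R| - 1) -
               Num.max 0 (`|ln (r y) - i.2%:~R| - 1)| <= 70 / 69 * (d / r x).
  apply: le_trans (max0_dist_le _ _) _.
  rewrite opprB addrA subrK; apply: le_trans (ler_dist_dist _ _) _.
  by rewrite opprB addrA subrK.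
move: part2; rewrite /spread -/dx -/dy; set u := Num.max _ _; set v := Num.max _ _.
move=> part2.
have -> : dx / r x + 17 * u - (dy / r y + 17 * v) =
          (dx / r x - dy / r y) + 17 * (u - v) by ring.
apply: le_trans (ler_normD _ _) _; rewrite [X in _ + X]normrM (@ger0_norm _ 17)//.
by lra.
Qed.

(** At this distance the exponents [n * spread] at [x] and [y] differ by at most
    [1], so the exponentials differ by [O(n * mdist x y / r x)] times the one at
    [x]. *)
Lemma node_weight_dist_le (x y : M) i : 0 < r x ->
  mdist x y <= r x / (70 * n) ->
  `|node_weight x i - node_weight y i| <=
    280 * n * (mdist x y / r x) *
    (if `[< near_nodes x i >] then mass i * expR (- (n * spread x i)) else 0).
Proof.
move=> x0 xy.
have n1 := n_ge1; have n0 : 0 < n by exact: lt_le_trans n1.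
have e0 : 0 <= mdist x y / r x by rewrite divr_ge0 ?mdist_ge0// ltW.
have n70 : 0 < 70 * n by rewrite mulr_gt0.
have en : n * (70 * (mdist x y / r x)) <= 1.
  have : mdist x y * (70 * n) <= r x by rewrite -ler_pdivlMr.
  have -> : n * (70 * (mdist x y / r x)) = mdist x y * (70 * n) / r x by ring.
  by move: (_ * (70 * n)) => q; rewrite ler_pdivrMr// mul1r.
have xy70 : mdist x y <= r x / 70.
  apply: le_trans xy _; rewrite ler_wpM2l ?(ltW x0)//.
  by rewrite lef_pV2 ?posrE//; lra.
have rhs0 b : 0 <= 280 * n * (mdist x y / r x) *
    (if b then mass i * expR (- (n * spread x i)) else 0).
  apply: mulr_ge0.
    by apply: mulr_ge0 e0; apply: mulr_ge0; [exact: ler0n|exact: ltW].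
  by case: b => //; rewrite mulr_ge0 ?expR_ge0// ltW// mass_gt0.
have [iN|iN] := pselect (is_node i); last first.
  by rewrite !node_weight_eq0 ?subrr ?normr0; [exact: rhs0|left|left].
have [/andP[xi yi]|] := boolP ((16 <= spread x i) && (16 <= spread y i)).
  by rewrite !node_weight_eq0 ?subrr ?normr0; [exact: rhs0|right|right].
rewrite negb_and -!ltNge => /orP xyi.
have := spread_dist_le x y i x0 xy70 xyi; set t := 70 * _ => st.
have t1 : t <= 1.
  by apply: le_trans en; rewrite -/t ler_peMl// /t mulr_ge0.
have near : near_nodes x i.
  split => //; move: st; rewrite ler_norml => /andP[_ st].
  by case: xyi => ?; lra.
rewrite asboolT// /node_weight asboolT// -mulrBr normrM.
rewrite (gtr0_norm (mass_gt0 i)) mulrCA ler_wpM2l ?(ltW (mass_gt0 i))//.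
apply: le_trans (max0_dist_le _ _) _; rewrite opprB addrA subrK.
have nt : `|n * spread x i - n * spread y i| <= n * t.
  by rewrite -mulrBr normrM (gtr0_norm n0) ler_wpM2l// ltW.
apply: le_trans (expRN_dist_le _ _ _ nt en) _.
by rewrite le_eqVlt; apply/orP; left; apply/eqP; rewrite /t; ring.
Qed.

Definition node_partition (x : M) (i : A * int) : R :=
  node_weight x i / \sum_(k \in [set: A * int]) node_weight x k.

Lemma node_weight_neq0 (x : M) i : node_weight x i != 0 ->
  is_node i /\ spread x i < 16.
Proof.
move=> wi; split.
  by apply: contra_notP (elimN eqP wi) => ?; exact/node_weight_eq0/or_introl.
by rewrite ltNge; apply: contra wi => ?; apply/eqP/node_weight_eq0; right.
Qed.

Lemma node_weight_near (x : M) i : 0 < r x -> node_weight x i != 0 ->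
  i \in fset_set (near_nodes x).
Proof.
move=> x0 /node_weight_neq0[iN xi]; apply/(near_nodesP x i x0); split => //.
by apply: lt_trans xi _; rewrite ltr_nat.
Qed.

Lemma sum_node_weightE (x : M) : 0 < r x ->
  \sum_(k \in [set: A * int]) node_weight x k =
  \sum_(k <- fset_set (near_nodes x)) node_weight x k.
Proof. by move=> x0; apply: fsumE => i; exact: node_weight_near. Qed.

Lemma node_partition_neq0 (x : M) i : node_partition x i != 0 ->
  node_weight x i != 0.
Proof.
by apply: contra => /eqP wi; rewrite /node_partition wi mul0r.
Qed.

Lemma sum_node_partition_dist_le (x y : M) (c : R) :
  0 <= c -> 0 < r x -> 0 < r y ->
  (forall i, `|node_weight x i - node_weight y i| <=
    c * (if `[< near_nodes x i >] then mass i * expR (- (n * spread x i)) else 0)) ->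
  \sum_(i \in [set: A * int]) `|node_partition x i - node_partition y i| <= 4 * c.
Proof.
move=> c0 x0 y0 bd; pose F := fset_set (near_nodes x).
have [W0 S2] := sum_exp_mass_le x x0.
have [Wy0 _] := sum_exp_mass_le y y0.
have wyF i : node_weight y i != 0 -> i \in F.
  apply: contraR => /(near_nodesP x i x0) nx; apply/eqP/normr0_eq0/le_anti.
  rewrite normr_ge0 andbT; have := bd i; rewrite asboolF// mulr0 distrC.
  rewrite (_ : node_weight x i = 0) ?subr0//; apply/eqP; apply: contra_notT nx.
  by move=> /(node_weight_near x i x0)/(near_nodesP x i x0).
rewrite -sum_node_weightE// in W0; rewrite -sum_node_weightE// in Wy0.
apply: le_trans (normalized_fsum_dist_le _ F _ _ _ wyF _ W0 Wy0) _.
- by move=> i; exact: node_weight_near.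
- exact: node_weight_ge0.
have sumF : \sum_(i <- F) `|node_weight x i - node_weight y i|
    <= c * (2 * \sum_(i <- F) node_weight x i).
  apply: le_trans (ler_wpM2l c0 S2).
  rewrite mulr_sumr big_seq [leRHS]big_seq; apply: ler_sum => i iF.
  apply: le_trans (bd i) _; rewrite asboolT//.
  exact/(near_nodesP x i x0).
rewrite ler_pdivrMr; last exact: W0.
rewrite sum_node_weightE//.
have -> : 4 * c * \sum_(i <- F) node_weight x i =
  2 * (c * (2 * \sum_(i <- F) node_weight x i)) by ring.
by apply: ler_wpM2l sumF; exact: ler0n.
Qed.

Lemma node_partition_gentle :
  gentle_partition A fst node_partition 16 (1 / (70 * n)) (1120 * n).
Proof.
move=> x x0; have [W0 _] := sum_exp_mass_le x x0.
have WE := sum_node_weightE x x0.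
split.
- apply: sub_finite_set (finite_near_nodes x x0) => i /= /node_partition_neq0.
  by move=> /(node_weight_near x i x0)/(near_nodesP x i x0).
- by move=> i; rewrite /node_partition WE divr_ge0 ?node_weight_ge0// ltW.
- rewrite (fsumE _ (fset_set (near_nodes x))) => [|i /node_partition_neq0].
    by rewrite /node_partition WE -mulr_suml divff// gt_eqF.
  exact: node_weight_near.
- move=> i /node_partition_neq0/node_weight_neq0[_ xi].
  apply: le_trans (mdist_le_spread x i x0) _.
  by rewrite ler_wpM2r ?(ltW x0)// ltW.
have n1 := n_ge1; have n0 : 0 < n by exact: lt_le_trans n1.
move=> y; rewrite mulrC mulrA mulr1 => xy.
have y0 : 0 < r y.
  have := set_dist_triangle A a x y.
  suff : r x / (70 * n) < r x by lra.
  by rewrite ltr_pdivrMr ?mulr_gt0// ltr_pMr//; lra.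
have bd i := node_weight_dist_le x y i x0 xy.
have c0 : 0 <= 280 * n * (mdist x y / r x).
  apply: mulr_ge0; first by apply: mulr_ge0; [exact: ler0n|exact: ltW].
  by apply: divr_ge0; [exact: mdist_ge0|exact: ltW].
have -> : 1120 * n * (mdist x y / r x) = 4 * (280 * n * (mdist x y / r x)) by ring.
exact: sum_node_partition_dist_le x y _ c0 x0 y0 bd.
Qed.

End exponential_partition.

(** * The extension theorem *)

Theorem theorem1p2 (R : realType) :
  exists c : R, 1 < c /\
    forall (M : metricType R) (Mo : set M) (mo : Mo)
      (mu : {measure set (borelType mo) -> \bar R}) (X : completeNormedModType R),
      is_doubling (mu : set Mo -> \bar R) ->
      exists E : {linear Lip Mo X -> Lip M X},
        simultaneous_extension E /\
        (ext_norm E <= (c * (log2 (fine (doubling_constant (mu : set Mo -> \bar R))) + 1))%:E)%E.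
Proof.
exists (300 * 300); split; first by lra.
move=> M Mo mo mu X dbl.
have D1 : 1 <= doubling_real mu := doubling_real_ge1 mu dbl.
pose n := ln (doubling_real mu) + 1.
have n1 : 1 <= n by rewrite lerDr ln_ge0.
have n0 : 0 < n by apply: lt_le_trans n1.
have n70 : 0 < 70 * n by rewrite mulr_gt0.
have gp := node_partition_gentle mu dbl n (lexx _).
have d0 : 0 < 1 / (70 * n) by rewrite divr_gt0.
have d1 : 1 / (70 * n) < 1 by rewrite ltr_pdivrMr// mul1r; lra.
have B0 : 0 <= 1120 * n by apply: mulr_ge0; [exact: ler0n|exact: ltW].
have K0 : 0 <= 16 :> R := ler0n _ _.
have [E [extE normE]] :=
  simultaneous_extension_of_gentle_partition mo (X := X) K0 d0 d1 B0 gp.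
exists E; split; first exact: extE.
apply: le_trans normE _; rewrite lee_fin.
have -> : 4 / (1 / (70 * n)) = 280 * n by field; rewrite gt_eqF.
(* The bound on the norm is [(36 * 1120 + 17 * 280) * n + 17]. *)
apply: (@le_trans _ _ (300 * 300 * n)).
  by clear -n1; lra.
apply: ler_wpM2l; first by lra.
rewrite lerD2r /log2 -/(doubling_real mu).
have ln20 : 0 < ln 2 :> R by rewrite ln_gt0// ltr1n.
have ln21 : ln 2 <= 1 :> R.
  have := @le_ln1Dx R 1; rewrite (_ : 1 + 1 = 2)//; apply.
  by lra.
by rewrite ler_pdivlMr// ler_piMr// ln_ge0.
Qed.
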